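(* Let $\mathcal H$ be a real Hilbert space, $K\subset\mathcal H$ a nonempty closed convex set, $q\ge1$ an integer, and let $f_i:\mathcal H\to\mathbb R$ ($i=1,\dots,q$) be convex continuous functions that are Lipschitz continuous on bounded sets (equivalently, $\partial f_i$ is bounded on bounded sets). Then for any strong global solution $u:[0,+\infty[\to\mathcal H$ of the Multi-Objective Gradient system $$\text{(MOG)}\qquad \dot u(t)+\Big(N_K(u(t))+\mathrm{Conv}\{\partial f_i(u(t))\}\Big)^0=0,$$ the following properties hold: i) (Descent property) for each $i=1,\dots,q$, $t\mapsto f_i(u(t))$ is a nonincreasing absolutely continuous function (on each bounded interval $[0,T]$), and for almost all $t>0$ $$\frac{d}{dt}f_i(u(t))\le-\|\dot u(t)\|^2.$$ ii) (Lipschitz continuity) $u$ is Lipschitz continuous on any finite time interval $[0,T]$. If moreover $u$ is bounded, then $u$ is Lipschitz continuous on $[0,+\infty[$.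
   Context: $N_K(u)=\{\eta\in\mathcal H:\langle\eta,v-u\rangle\le0\ \forall v\in K\}$ for $u\in K$ (and $N_K(u)=\emptyset$ for $u\notin K$) is the normal cone; $\partial f_i$ is the convex subdifferential. $\mathcal S^q=\{\theta\in\mathbb R^q:0\le\theta_i\le1,\ \sum_i\theta_i=1\}$ and $\mathrm{Conv}\{\partial f_i(u)\}=\{\sum_{i=1}^q\theta_ip_i:\ p_i\in\partial f_i(u),\ (\theta_i)\in\mathcal S^q\}$. For a nonempty closed convex set $C$, $C^0$ is its element of minimal norm. A strong global solution of (MOG) is a function $u:[0,+\infty[\to\mathcal H$ such that: (i) $u$ is absolutely continuous on each interval $[0,T]$, $0<T<+\infty$ (i.e. $u(t)=u(0)+\int_0^tg(s)\,ds$ for some integrable $g:[0,T]\to\mathcal H$); (ii) there exist $\eta:[0,+\infty[\to\mathcal H$, $v_i:[0,+\infty[\to\mathcal H$, $\theta_i:[0,+\infty[\to[0,1]$ ($i=1,\dots,q$) with $\theta_i\in L^\infty(0,+\infty;\mathbb R)$, $(\theta_i(t))\in\mathcal S^q$ for a.e. $t>0$; $v_i\in L^\infty(0,T;\mathcal H)$ and $\eta\in L^2(0,T;\mathcal H)$ for all $T>0$; and for a.e. $t>0$: $\eta(t)\in N_K(u(t))$, $v_i(t)\in\partial f_i(u(t))$, $\dot u(t)+\eta(t)+\sum_i\theta_i(t)v_i(t)=0$, and $\dot u(t)+\big(N_K(u(t))+\mathrm{Conv}\{\partial f_i(u(t))\}\big)^0=0$. *)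

(* Defs.v *)
From HB Require Import structures.
From mathcomp Require Import all_boot all_order all_algebra sesquilinear.
From mathcomp Require Import all_classical all_reals all_analysis.

Set Implicit Arguments.
Unset Strict Implicit.
Unset Printing Implicit Defensive.

Import Order.TTheory GRing.Theory Num.Theory.
Import numFieldNormedType.Exports.

Local Open Scope classical_set_scope.
Local Open Scope ring_scope.

Section bochner.
Context d (T : measurableType d) (R : realType).
Context (mu : {measure set T -> \bar R}) (V : normedModType R).
Implicit Types (D : set T) (s g : T -> V).

Definition simple_function s : Prop :=
  finite_set (range s) /\ (forall y : V, measurable (s @^-1` [set y])).

Definition ae_cvg D (s_ : nat -> T -> V) g : Prop :=
  {ae mu, forall x, D x -> s_ n x @[n --> \oo] --> g x}.

Definition strongly_measurable D g : Prop :=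
  exists2 s_ : nat -> T -> V,
    (forall n, simple_function (s_ n)) & ae_cvg D s_ g.

(* The fiber over 0 may have infinite measure; [fine] sends it to 0 and the
   term vanishes anyway. *)
Definition simple_integral D s : V :=
  \sum_(y \in range s) fine (mu (D `&` s @^-1` [set y])) *: y.

(* [is_bochner_integral D g I]: g is Bochner integrable on D, with integral I. *)
Definition is_bochner_integral D g (I : V) : Prop :=
  exists s_ : nat -> T -> V,
    [/\ forall n, simple_function (s_ n) /\
          (\int[mu]_(x in D) `|s_ n x|%:E < +oo)%E,
        ae_cvg D s_ g,
        (\int[mu]_(x in D) `|g x - s_ n x|%:E)%E @[n --> \oo] --> 0%E &
        simple_integral D (s_ n) @[n --> \oo] --> I].

Definition in_Linfty D g : Prop :=
  strongly_measurable D g /\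
  exists M : R, {ae mu, forall x, D x -> `|g x| <= M}.

Definition in_L2 D g : Prop :=
  strongly_measurable D g /\ (\int[mu]_(x in D) (`|g x| ^+ 2)%:E < +oo)%E.

End bochner.

Definition abs_continuous (R : realType) (V : normedModType R) (T : R)
    (u : R -> V) : Prop :=
  exists2 g : R -> V,
    (exists I, is_bochner_integral (@lebesgue_measure R) `[0, T] g I) &
    forall t, t \in `[0, T] ->
      is_bochner_integral (@lebesgue_measure R) `[0, t] g (u t - u 0).

Section convex_analysis.
Context (R : realType) (H : normedModType R) (dot : {dot H for idfun}).

Definition normal_cone (K : set H) (u : H) : set H :=
  [set eta | K u /\ forall v, K v -> dot eta (v - u) <= 0].

Definition subdifferential (f : H -> R) (u : H) : set H :=
  [set p | forall v, f u + dot p (v - u) <= f v].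

Definition unit_simplex (q : nat) : set ('I_q -> R) :=
  [set theta | (forall i, 0 <= theta i <= 1) /\ \sum_(i < q) theta i = 1].

Definition conv_subdifferential (q : nat) (f : 'I_q -> H -> R) (u : H) :
    set H :=
  [set w | exists theta p,
    [/\ unit_simplex theta, forall i, subdifferential (f i) u (p i) &
        w = \sum_(i < q) theta i *: p i]].

(* [least_norm C z] stands for z = C^0; for C convex, such a z is unique. *)
Definition least_norm (C : set H) (z : H) : Prop :=
  C z /\ forall y, C y -> `|z| <= `|y|.

(* Functions on [0, +oo[ are represented by functions on R whose values at
   negative arguments are never used. As [derive1] is total, the equations in
   u' only make sense together with [derivable u t 1]. *)
Record strong_global_solution (K : set H) (q : nat) (f : 'I_q -> H -> R)
    (u : R -> H) : Prop := {
  sgs_abs_continuous : forall T : R, 0 < T -> abs_continuous T u ;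
  sgs_equation : exists (eta : R -> H) (v : 'I_q -> R -> H)
                        (theta : 'I_q -> R -> R),
    [/\ forall i (t : R), 0 <= t -> 0 <= theta i t <= 1,
        forall i, in_Linfty (@lebesgue_measure R) `]0, +oo[ (theta i),
        {ae (@lebesgue_measure R), forall t : R, 0 < t ->
          unit_simplex (fun i => theta i t)},
        forall T : R, 0 < T ->
          (forall i, in_Linfty (@lebesgue_measure R) `]0, T[ (v i)) /\
          in_L2 (@lebesgue_measure R) `]0, T[%classic eta &
        {ae (@lebesgue_measure R), forall t : R, 0 < t ->
          [/\ normal_cone K (u t) (eta t),
              forall i, subdifferential (f i) (u t) (v i t),
              derivable u t 1,
              derive1 u t + eta t + \sum_(i < q) theta i t *: v i t = 0 &
              least_norm
                [set a + b | a in normal_cone K (u t) &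
                             b in conv_subdifferential f (u t)]
                (- derive1 u t)]}]
}.

End convex_analysis.

(* Main.v *)
(** Since -u' is the element of minimal norm of the convex set
    N_K(u) + Conv {df_i(u)}, which contains df_i(u), every subgradient p of
    f_i at u satisfies <u', p> <= -|u'|^2; in particular |u'| <= |p|, which is
    bounded on bounded sets.  Testing the Bochner integral defining u against
    vectors w of norm at most 1 reduces the Lipschitz estimate on u to
    Lebesgue's differentiation theorem for real functions.
    Then phi = f_i o u is Lipschitz, and the subgradient inequality says that
    phi(t + h) - phi(t) >= <u'(t), p> h - o(h) for h of both signs, for a.e. t.
    A Lipschitz function with such a lower bound is the integral of some psi
    (Fatou's lemma applied to forward and to backward difference quotients);
    hence phi' = psi <= <u', p> <= -|u'|^2 a.e.  The convexity of f_i enters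
    only through the existence of subgradients along u. *)
Require Import Defs.
From HB Require Import structures.
From mathcomp Require Import all_boot all_order all_algebra sesquilinear.
From mathcomp Require Import all_classical all_reals all_analysis.
From mathcomp Require Import finmap measurable_realfun ring lra.

Set Implicit Arguments.
Unset Strict Implicit.
Unset Printing Implicit Defensive.

Import Order.TTheory GRing.Theory Num.Theory.
Import numFieldNormedType.Exports.

Local Open Scope classical_set_scope.
Local Open Scope ring_scope.

(** * Inner products, subgradients and the element of minimal norm *)

Section hilbert.
Context (R : realType) (H : normedModType R) (dot : {dot H for idfun}).
Hypothesis dot_norm : forall x : H, dot x x = `|x| ^+ 2.
Implicit Types (x y z p w : H) (K : set H).

Lemma dotC x y : dot x y = dot y x.
Proof. by have := hermC dot x y; rewrite /= expr0 mul1r. Qed.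

Lemma dotZl (a : R) x y : dot (a *: x) y = a * dot x y.
Proof. by rewrite linearZl_LR. Qed.

Lemma dotZr (a : R) x y : dot x (a *: y) = a * dot x y.
Proof. by rewrite linearZr_LR. Qed.

Lemma dotDl x y z : dot (x + y) z = dot x z + dot y z.
Proof. exact: linearDl. Qed.

Lemma dotDr x y z : dot x (y + z) = dot x y + dot x z.
Proof. exact: linearDr. Qed.

Lemma dotBl x y z : dot (x - y) z = dot x z - dot y z.
Proof. exact: linearBl. Qed.

Lemma dotBr x y z : dot x (y - z) = dot x y - dot x z.
Proof. exact: linearBr. Qed.

Lemma dotNl x y : dot (- x) y = - dot x y.
Proof. exact: linearNl. Qed.

Lemma dotNr x y : dot x (- y) = - dot x y.
Proof. exact: linearNr. Qed.

Definition dotE := (dotDl, dotDr, dotNl, dotNr, dotZl, dotZr).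

(** Cauchy-Schwarz: the squared norm of [|y| *: x - |x| *: y] expands to
    [2 |x| |y| (|x| |y| - dot x y)]. *)
Lemma dot_le_norm x y : dot x y <= `|x| * `|y|.
Proof.
have [->|x0] := eqVneq x 0; first by rewrite linear0l normr0 mul0r.
have [->|y0] := eqVneq y 0; first by rewrite linear0r normr0 mulr0.
have xy0 : 0 < `|x| * `|y| by rewrite mulr_gt0 ?normr_gt0.
rewrite -(ler_pM2l xy0) -subr_ge0.
have := sqr_ge0 `| `|y| *: x - `|x| *: y |.
rewrite -dot_norm !dotE.
rewrite (dotC y x) !dot_norm; nra.
Qed.

Lemma normr_dot_le x y : `|dot x y| <= `|x| * `|y|.
Proof.
rewrite ler_norml dot_le_norm andbT lerNl -dotNl.
by rewrite -(normrN x) dot_le_norm.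
Qed.

(** Test with [w = x / |x|]. This turns norm bounds on vectors into bounds on real functions. *)
Lemma le_norm_dot x (C : R) : 0 <= C ->
  (forall w, `|w| <= 1 -> dot x w <= C) -> `|x| <= C.
Proof.
move=> C0 xC; have [->|x0] := eqVneq x 0; first by rewrite normr0.
have := xC (`|x|^-1 *: x); rewrite dotZr /= dot_norm expr2.
have nx0 : `|x| != 0 by rewrite normr_eq0.
rewrite mulKf //; apply.
by rewrite normrZ normfV normr_id mulVf.
Qed.

Lemma dot_continuous w : continuous (dot ^~ w).
Proof.
move=> x; apply/cvgrPdist_le => e e0; near=> y.
rewrite -dotBl (le_trans (normr_dot_le _ _)) //.
have w1 : 0 < `|w| + 1 by rewrite ltr_wpDl.
have : `|x - y| <= e / (`|w| + 1).
  near: y; apply: cvgr_dist_le; first exact: cvg_id.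
  by rewrite divr_gt0.
rewrite ler_pdivlMr //; have := normr_ge0 (x - y); nra.
Unshelve. all: by end_near. Qed.

(** Moving from [z] towards [y] by a fraction [l] cannot lower the norm; the first-order term in [l]
    of the squared norm gives the variational inequality of the projection of 0. *)
Lemma least_norm_dot (C : set H) z y :
  (forall l : R, 0 < l < 1 -> C ((1 - l) *: z + l *: y)) ->
  least_norm C z -> `|z| ^+ 2 <= dot z y.
Proof.
move=> seg [_ zmin]; apply/ler_addgt0Pr => e e0.
pose M := `|y - z| ^+ 2.
have M0 : 0 <= M by exact: sqr_ge0.
(* Small enough for the remainder [l * M] to stay below [e]; [M + 1] keeps the denominator positive
   when [y = z]. *)
pose l := Num.min (1 / 2) (e / (M + 1)).
have l0 : 0 < l.
  by rewrite lt_min divr_gt0 //= divr_gt0 // ltr_wpDl.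
have l1 : l <= 1 / 2 by rewrite ge_min lexx.
have lM : l * (M + 1) <= e.
  by rewrite -ler_pdivlMr ?ltr_wpDl // ge_min lexx orbT.
have /seg/zmin : 0 < l < 1 by rewrite l0 /=; lra.
have -> : (1 - l) *: z + l *: y = z + l *: (y - z).
  by rewrite scalerBl scale1r scalerBr addrAC -addrA.
rewrite -(ler_pXn2r (n := 2)) ?nnegrE // -(dot_norm (_ + _)).
rewrite dotDl !dotDr !(dotZl, dotZr).
rewrite (dotC (y - z) z) !dot_norm -/M dotBr dot_norm => h.
have : 0 <= l * (2 * (dot z y - `|z| ^+ 2) + l * M) by nra.
rewrite pmulr_rge0 //; nra.
Qed.

(** The normal cone absorbs the factor [1 - l]. As a convex combination holds one subgradient per
    index, [p] is merged with [v i] into their weighted mean, again a subgradient of [f i]. *)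
Lemma mog_set_segment K (q : nat) (f : 'I_q -> H -> R) x z i p (l : R) :
  [set a + b | a in normal_cone dot K x &
               b in conv_subdifferential dot f x] z ->
  subdifferential dot (f i) x p -> 0 < l < 1 ->
  [set a + b | a in normal_cone dot K x &
               b in conv_subdifferential dot f x] ((1 - l) *: z + l *: p).
Proof.
move=> [a [Kx Na] [b [theta [v [[th01 th1] vf ->]]] <-]] fp /andP[l0 l1].
exists ((1 - l) *: a).
  by split=> // y Ky; rewrite dotZl /=; have := Na _ Ky; nra.
pose th j := (1 - l) * theta j + (if j == i then l else 0).
pose v' j := if j == i then
  (th i)^-1 *: (((1 - l) * theta i) *: v i + l *: p) else v j.
have thi0 : 0 < th i.
  have t0 : 0 <= (1 - l) * theta i by have /andP[] := th01 i; nra.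
by rewrite /th eqxx; nra.
have sumth : \sum_(j < q) th j = 1.
  rewrite big_split /= -mulr_sumr th1 -big_mkcond big_pred1_eq /=; ring.
exists (\sum_(j < q) th j *: v' j); last first.
  rewrite scalerDr -addrA; congr (_ + _).
  rewrite scaler_sumr (bigD1 i) //= [in RHS](bigD1 i) //= /v' eqxx.
  rewrite scalerA divff ?gt_eqF // scale1r scalerA addrAC; congr (_ + _).
  congr (_ + _); apply: eq_bigr => j /negPf ji.
  by rewrite /th ji addr0 scalerA.
exists th, v'; split => //.
  split => // j; have th0 k : 0 <= th k.
    by rewrite /th; have /andP[] := th01 k; case: eqP => _; nra.
  by rewrite th0 /= -sumth (bigD1 j) //= lerDl sumr_ge0.
move=> j; rewrite /v'; case: eqP => [->|_] //; move=> y.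
have := vf i y; have := fp y.
rewrite dotZl dotDl !dotZl => h1 h2.
rewrite -lerBrDl ler_pdivrMl //.
have t0 : 0 <= (1 - l) * theta i by have /andP[] := th01 i; nra.
by rewrite /th eqxx; nra.
Qed.

Lemma least_norm_subdifferential K (q : nat) (f : 'I_q -> H -> R) x z i p :
  least_norm [set a + b | a in normal_cone dot K x &
                          b in conv_subdifferential dot f x] z ->
  subdifferential dot (f i) x p -> `|z| ^+ 2 <= dot z p.
Proof.
move=> zmin fp; apply: least_norm_dot (zmin) => l l01.
by apply: mog_set_segment => //; exact: zmin.1.
Qed.

(** The subgradient is tested at [x + w] with [|w| <= 1], a point of the ball of radius [M + 1];
    hence the enlarged radius. *)
Lemma norm_subdifferential_le (f : H -> R) x p (M L : R) : 0 <= L ->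
  (forall y z, `|y| <= M + 1 -> `|z| <= M + 1 ->
     `|f y - f z| <= L * `|y - z|) ->
  `|x| <= M -> subdifferential dot f x p -> `|p| <= L.
Proof.
move=> L0 fL xM fp; apply: le_norm_dot => // w w1.
have := fp (x + w); rewrite addrAC subrr add0r => fw.
have : `|f (x + w) - f x| <= L * `|x + w - x|.
  apply: fL; last by rewrite (le_trans xM) // lerDl.
  by rewrite (le_trans (ler_normD _ _)) // lerD.
rewrite addrAC subrr add0r => /(le_trans (ler_norm _)).
have : L * `|w| <= L by rewrite ler_piMr.
lra.
Qed.

End hilbert.

(** * Bochner integrals seen through linear forms *)

Section scalarization.
Context d (T : measurableType d) (R : realType).
Context (mu : {measure set T -> \bar R}).

(* No measurability assumption: the integral of a nonnegative function is
   a supremum over the simple functions below it. *)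
Lemma ge0_le_integral_any (D : set T) (f g : T -> \bar R) :
  (forall x, D x -> 0 <= f x)%E -> (forall x, D x -> f x <= g x)%E ->
  (\int[mu]_(x in D) f x <= \int[mu]_(x in D) g x)%E.
Proof.
move=> f0 fg; rewrite !ge0_integralE //; last first.
  by move=> x Dx; apply: le_trans (fg _ Dx); exact: f0.
apply: le_ereal_sup => _ [h /= hf <-]; exists h => //= x.
exact: le_trans (hf x) (lee_restrict fg x).
Qed.

Lemma EFin_Rintegral_normr (D : set T) (f : T -> R) : measurable D ->
  mu.-integrable D (EFin \o f) ->
  ((\int[mu]_(x in D) `|f x|)%R%:E = \int[mu]_(x in D) `|f x|%:E)%E.
Proof.
by move=> mD intf; rewrite fineK //; apply: integrable_fin_num => //;
  exact: (integrable_abse intf).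
Qed.

(** For any map [k], [k \o s] is a finite combination of indicators of fibers of [s]. Finiteness of
    [mu D] matters because [k 0] may differ from 0. *)
Lemma comp_simple_function_integral (V : normedModType R) (D : set T)
    (s : T -> V) (k : V -> R) :
  measurable D -> (mu D < +oo)%E -> simple_function s ->
  mu.-integrable D (fun x => (k (s x))%:E) /\
  (\int[mu]_(x in D) k (s x))%R =
    \sum_(y <- fset_set (range s)) fine (mu (D `&` s @^-1` [set y])) * k y.
Proof.
move=> mD muD [fs ms].
pose F y x := (k y * \1_(s @^-1` [set y]) x)%:E.
have intF y : mu.-integrable D (F y).
  apply: (measurable_bounded_integrable (f := fun x => k y * _)) => //.
    apply: measurable_funM => //; apply: measurable_indic; exact: ms.
  exists `|k y|; split; first exact: num_real.
  move=> M kM x Dx /=; rewrite normrM (le_trans _ (ltW kM)) //.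
  by rewrite ler_piMr // indicE; case: (_ \in _); rewrite ?normr1 ?normr0.
have sE : (fun x => (k (s x))%:E) =
    (fun x => \sum_(y <- fset_set (range s)) F y x)%E.
  apply/funext => x; rewrite sumEFin; congr (_%:E).
  rewrite (big_fsetD1 (s x)) /=; last first.
    by rewrite in_fset_set //; apply/mem_set; exists x.
  rewrite indicE mem_set // mulr1 big_seq big1 ?addr0 // => y.
  move=> /finmap.fsetD1P[yx _]; rewrite indicE memNset ?mulr0 //= => xy.
  by rewrite xy eqxx in yx.
rewrite sE; split; first by apply: integrable_sum.
rewrite /Rintegral sE integral_sum // -sum_fine; last first.
  by move=> y _; apply: integrable_fin_num.
apply: eq_bigr => y _.
have i1 : mu.-integrable D (fun x => (\1_(s @^-1` [set y]) x)%:E).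
  apply: (measurable_bounded_integrable (f := fun x => \1_(_) x)) => //.
    apply: measurable_indic; exact: ms.
  exists 1; split; first exact: num_real.
  move=> M M1 x Dx /=; rewrite (le_trans _ (ltW M1)) //.
  by rewrite indicE; case: (_ \in _); rewrite ?normr1 ?normr0.
rewrite /F; under eq_integral do rewrite EFinM.
rewrite integralZl // fineM //; last exact: integrable_fin_num.
by rewrite integral_indic //= mulrC setIC.
Qed.

Lemma simple_integral_scalar (V : normedModType R) (D : set T)
    (s : T -> V) (k : {scalar V}) :
  measurable D -> (mu D < +oo)%E -> simple_function s ->
  k (simple_integral mu D s) = (\int[mu]_(x in D) k (s x))%R.
Proof.
move=> mD muD sf; have [_ ->] := comp_simple_function_integral k mD muD sf.
rewrite /simple_integral fsbig_finite ?linear_sum; last exact: sf.1.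
by apply: eq_bigr => y _; rewrite linearZ.
Qed.

(* [mu] need not be complete, so [k \o g] need not be measurable: [G] is its
   restriction to the convergence set of the simple functions. The bound [C]
   is uniform in [k], hence gives bounds in norm. *)
Lemma is_bochner_integral_scalar (V : normedModType R) (D : set T)
    (g : T -> V) (I : V) :
  measurable D -> (mu D < +oo)%E -> is_bochner_integral mu D g I ->
  exists C : R, forall k : {scalar V}, (forall x, `|k x| <= `|x|) ->
  exists G : T -> R,
  [/\ mu.-integrable D (EFin \o G),
      {ae mu, forall x, D x -> G x = k (g x)},
      (\int[mu]_(x in D) G x)%R = k I &
      (\int[mu]_(x in D) `|G x| <= C)%R].
Proof.
move=> mD muD [s_ [sf [N [mN N0 sN]] gs sI]].
(* A single [s_ m] close to [g] fixes [C] before [k] is chosen. *)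
have [m m1] : exists m, (\int[mu]_(x in D) `|g x - s_ m x|%:E < 1)%E.
  have := gs _ (@nbhs_open_ereal_lt _ 0%R (fun=> 1) ltr01).
  by case=> m _ /(_ m (leqnn m)) /= h; exists m.
pose C := fine (\int[mu]_(x in D) `|s_ m x|%:E) + 1.
exists C => k kle.
have k_cont : continuous k.
  move=> x; apply/cvgrPdist_le => e e0; near=> y.
  rewrite -linearB (le_trans (kle _)) //; near: y.
pose E := D `\` N; have mE : measurable E by exact: measurableD.
pose G := (fun x => k (g x)) \_ E.
have GE x : E x -> G x = k (g x) by move=> Ex; rewrite /G patchE mem_set.
have GN x : ~ E x -> G x = 0 by move=> Ex; rewrite /G patchE memNset.
have aeG : {ae mu, forall x, D x -> G x = k (g x)}.
  exists N; split => // x /=; apply: contra_notP => Nx Dx.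
  by rewrite GE.
have h_int n := (comp_simple_function_integral k mD muD (sf n).1).1.
have mG : measurable_fun D G.
  pose h n := (fun x => k (s_ n x)) \_ E.
  apply: (@measurable_fun_cvg _ _ _ _ h) => [n|x Dx].
    apply: measurable_funTS; apply/(measurable_restrictT _ mE).1.
    apply: (@measurable_funS _ _ _ _ D) => //; first exact: subDsetl.
    by have /integrableP[/measurable_EFinP] := h_int n.
  have [Ex|nEx] := pselect (E x); last first.
    rewrite GN // (_ : (fun _ => _) = fun=> 0); first exact: cvg_cst.
    by apply/funext => n; rewrite /h patchE memNset.
  rewrite GE // (_ : (fun _ => _) = fun n => k (s_ n x)).
    apply: continuous_cvg; first exact: k_cont.
    by apply: contrapT => nc; apply: Ex.2; apply: sN => /= /(_ Ex.1).
  by apply/funext => n; rewrite /h patchE mem_set.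
have mk n : measurable_fun D (fun x => k (s_ n x)).
  by have /integrableP[/measurable_EFinP] := h_int n.
(* [k] does not increase norms, and [G] is [k \o g] off the null set [N]. The integrand on the right
   may fail to be measurable, hence [ge0_le_integral_any]. *)
have Gh n : (\int[mu]_(x in D) `|G x - k (s_ n x)|%:E <=
             \int[mu]_(x in D) `|g x - s_ n x|%:E)%E.
  rewrite (ge0_negligible_integral (N := N)) //; last first.
    by apply/measurable_EFinP/measurableT_comp => //; exact: measurable_funB.
  rewrite -/E integral_mkcond [leRHS]integral_mkcond.
  apply: ge0_le_integral_any => x _.
    by rewrite patchE; case: ifP.
  rewrite [leLHS]patchE; case: ifPn => [/set_mem Ex|_]; last first.
    exact: erestrict_ge0.
  rewrite patchE mem_set; last exact: Ex.1.
  by rewrite lee_fin GE // -linearB.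
have G_int : mu.-integrable D (EFin \o G) /\
    (\int[mu]_(x in D) `|G x|%:E <= C%:E)%E.
  have GC : (\int[mu]_(x in D) `|G x|%:E <= C%:E)%E.
    apply: (@le_trans _ _ (\int[mu]_(x in D)
        (`|k (s_ m x)|%:E + `|G x - k (s_ m x)|%:E))%E).
      apply: ge0_le_integral_any => x Dx; rewrite // -EFinD lee_fin.
      by rewrite -{1}(subrKC (k (s_ m x)) (G x)) ler_normD.
    rewrite ge0_integralD //; last 2 first.
    - by apply/measurable_EFinP/measurableT_comp.
    - by apply/measurable_EFinP/measurableT_comp => //; exact: measurable_funB.
    rewrite EFinD; apply: leeD; last exact: le_trans (Gh m) (ltW m1).
    rewrite fineK; last first.
      by rewrite ge0_fin_numE ?(sf m).2 // integral_ge0.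
    by apply: ge0_le_integral_any => x Dx; rewrite // lee_fin.
  split=> //; apply/integrableP; split; first exact/measurable_EFinP.
  by rewrite (le_lt_trans GC) // ltry.
have [iG GC] := G_int.
exists G; split => //; last first.
  by rewrite -lee_fin EFin_Rintegral_normr.
have kI : k (simple_integral mu D (s_ n)) @[n --> \oo] --> k I.
  by apply: continuous_cvg => //; exact: k_cont.
(* The same sequence tends to [k I], so uniqueness of limits identifies the integral of [G]. *)
suff : k (simple_integral mu D (s_ n)) @[n --> \oo] -->
    (\int[mu]_(x in D) G x)%R.
  by move=> /cvg_unique/(_ kI); apply; exact: Rhausdorff.
apply/cvgrPdist_le => e e0.
have : \forall n \near \oo, (\int[mu]_(x in D) `|g x - s_ n x|%:E < e%:E)%E.
  exact: gs _ (@nbhs_open_ereal_lt _ 0%R (fun=> e) e0).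
apply: filterS => n /= ne; rewrite simple_integral_scalar //; last first.
  exact: (sf n).1.
have ik := h_int n.
rewrite -RintegralB // (le_trans (le_normr_Rintegral _ _)) //.
  exact: (integrableB mD iG ik).
rewrite -lee_fin EFin_Rintegral_normr //; last first.
  exact: (integrableB mD iG ik).
exact: le_trans (Gh n) (ltW ne).
Unshelve. all: by end_near. Qed.

Import HBSimple.

(** Simple functions approximate [G] in [L^1]; the identity is a linear form on the reals, so their
    [simple_integral] is the usual integral. This later yields the absolute continuity of [f i]
    along [u]. *)
Lemma integrable_is_bochner_integral (D : set T) (G : T -> R) :
  measurable D -> (mu D < +oo)%E -> mu.-integrable D (EFin \o G) ->
  is_bochner_integral mu D G (\int[mu]_(x in D) G x)%R.
Proof.
move=> mD muD iG.
have [s_ [is_ cs s0]] := approximation_sfun_integrable mD iG.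
have sf n : simple_function (s_ n : T -> R).
  split; first exact: fimfunP.
  by move=> y; exact: measurable_funPTI.
exists (fun n => s_ n); split => //.
- move=> n; split => //.
  by have /integrableP[] := is_ n.
- exists set0; split => // x /= nx; exfalso; apply: nx => Dx.
  by have /fine_cvgP[] := cs x Dx.
- have sE n : simple_integral mu D (s_ n : T -> R) =
      (\int[mu]_(x in D) s_ n x)%R.
    exact: (@simple_integral_scalar R D (s_ n) idfun mD muD (sf n)).
  apply/cvgrPdist_le => e e0.
  have : \forall n \near \oo, (\int[mu]_(x in D) `|G x - s_ n x|%:E < e%:E)%E.
    exact: s0 _ (@nbhs_open_ereal_lt _ 0%R (fun=> e) e0).
  apply: filterS => n /= ne; rewrite sE -RintegralB //.
  rewrite (le_trans (le_normr_Rintegral _ _)) //.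
    exact: (integrableB mD iG (is_ n)).
  rewrite -lee_fin EFin_Rintegral_normr //; last first.
    exact: (integrableB mD iG (is_ n)).
  exact: ltW.
Qed.

End scalarization.

(** * Fatou's lemma for uniformly bounded sequences of real functions *)

Section liminf.
Context d (T : measurableType d) (R : realType).
Context (mu : {measure set T -> \bar R}).
Variables (u : nat -> T -> R) (L : R).
Hypothesis uL : forall n x, `|u n x| <= L.
Let psi x := fine (limn_einf (fun n => (u n x)%:E)).

Let einf_ge x (b : R) : (\forall n \near \oo, b <= u n x) ->
  (b%:E <= limn_einf (fun n => (u n x)%:E))%E.
Proof.
move=> bu; rewrite limn_einf_lim; apply: lime_ge.
  exact: is_cvg_einfs.
case: bu => N _ bu; exists N => // n /= Nn.
apply: le_ereal_inf_tmp => _ [m /= nm <-].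
by rewrite lee_fin bu //= (leq_trans Nn).
Qed.

(** All terms lie in [[-L, L]], hence so does their lower limit, and [fine] loses nothing. *)
Let einf_fin x : limn_einf (fun n => (u n x)%:E) = (psi x)%:E.
Proof.
rewrite fineK // fin_real //; apply/andP; split.
  apply: (@lt_le_trans _ _ (- L)%:E); first exact: ltNyr.
  apply: einf_ge; apply: nearW => n.
  by have := uL n x; rewrite ler_norml => /andP[].
apply: (@le_lt_trans _ _ L%:E); last exact: ltry.
rewrite limn_einf_lim; apply: lime_le; first exact: is_cvg_einfs.
apply: nearW => n; apply: ereal_inf_le; exists (u n x)%:E.
  by exists n => /=.
by rewrite lee_fin (le_trans (ler_norm _)).
Qed.

Lemma fine_limn_einf_ge x (b : R) : (\forall n \near \oo, b <= u n x) ->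
  b <= psi x.
Proof. by move=> /einf_ge; rewrite einf_fin lee_fin. Qed.

Lemma normr_fine_limn_einf x : `|psi x| <= L.
Proof.
rewrite ler_norml fine_limn_einf_ge ?andTb; last first.
  by apply: nearW => n; have := uL n x; rewrite ler_norml => /andP[].
rewrite -lee_fin -einf_fin limn_einf_lim; apply: lime_le.
  exact: is_cvg_einfs.
apply: nearW => n; apply: ereal_inf_le; exists (u n x)%:E.
  by exists n => /=.
by rewrite lee_fin (le_trans (ler_norm _)).
Qed.

Hypothesis mu_ : forall n, measurable_fun setT (u n).

Lemma measurable_fine_limn_einf : measurable_fun setT psi.
Proof.
apply/measurable_EFinP; rewrite (_ : EFin \o _ =
  fun x => - limn_esup (fun n => - (u n x)%:E))%E; last first.
  by apply/funext => x; rewrite /= -einf_fin /limn_einf.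
apply: measurableT_comp => //; apply: measurable_fun_limn_esup => n.
by apply/measurableT_comp => //; exact/measurable_EFinP.
Qed.

(** Fatou's lemma is applied to the nonnegative functions [L + u n]; the integral of [L] over [D] is
    finite and cancels. *)
Lemma fatou_fine_limn_einf (D : set T) (a : R) :
  measurable D -> (mu D < +oo)%E ->
  (\int[mu]_(x in D) u n x)%R @[n --> \oo] --> a ->
  (\int[mu]_(x in D) psi x)%R <= a.
Proof.
move=> mD muD ua.
have iu (v : T -> R) : measurable_fun setT v -> (forall x, `|v x| <= L) ->
    mu.-integrable D (EFin \o v).
  move=> mv vL; apply: measurable_bounded_integrable => //.
    exact: measurable_funTS.
  exists L; split; first exact: num_real.
  by move=> M LM x _ /=; rewrite (le_trans (vL x)) // ltW.
have icst : mu.-integrable D (EFin \o cst L).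
  apply: measurable_bounded_integrable => //.
  exists `|L|; split; first exact: num_real.
  by move=> M LM x _ /=; rewrite ltW.
have ipsi := iu _ measurable_fine_limn_einf normr_fine_limn_einf.
have iun n := iu _ (mu_ n) (uL n).
have uL0 n x : 0 <= L + u n x.
  by rewrite -lerBlDl sub0r; have := uL n x; rewrite ler_norml => /andP[].
have := @fatou _ _ _ mu D mD (fun n x => (L + u n x)%:E).
have shift x : limn_einf (fun n => (L + u n x)%:E) = (L + psi x)%:E.
  rewrite (_ : (fun n => _) = fun n => L%:E + (u n x)%:E)%E //.
  by rewrite limn_einf_shift // einf_fin.
under eq_integral do rewrite shift.
move=> H; have {H} : (\int[mu]_(x in D) (L + psi x)%:E <=
    limn_einf (fun n => \int[mu]_(x in D) (L + u n x)%:E))%E.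
  apply: H => [n|n x _]; last by rewrite lee_fin.
  apply/measurable_EFinP/measurable_funTS.
  by apply: measurable_funD => //; exact: mu_.
have E v : mu.-integrable D (EFin \o v) ->
    (\int[mu]_(x in D) (L + v x)%:E =
    ((\int[mu]_(x in D) L)%R + (\int[mu]_(x in D) v x)%R)%:E)%E.
  move=> iv; rewrite -RintegralD // fineK //.
  by apply: integrable_fin_num => //; exact: (integrableD mD icst iv).
rewrite E // (_ : (fun n => _) = fun n =>
  ((\int[mu]_(x in D) L)%R + (\int[mu]_(x in D) u n x)%R)%:E); last first.
  by apply/funext => n; rewrite E.
have /cvg_limn_einf_sup[-> _] :
    ((\int[mu]_(x in D) L)%R + (\int[mu]_(x in D) u n x)%R)%:E @[n --> \oo]
    --> ((\int[mu]_(x in D) L)%R + a)%:E.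
  by apply: cvg_EFin; [exact: nearW|apply: cvgD => //; exact: cvg_cst].
by rewrite lee_fin lerD2l.
Qed.

End liminf.

(** * Derivatives and increments of integrals on real intervals *)

Section real_line.
Context (R : realType).
Notation mu := (@lebesgue_measure R).
Implicit Types (G phi : R -> R) (a b s t L : R).

Lemma lebesgue_itv_lty a b (b0 b1 : bool) :
  (mu [set` Interval (BSide b0 a) (BSide b1 b)] < +oo)%E.
Proof.
by rewrite lebesgue_measure_itv; case: ifP => // _; rewrite -EFinD ltry.
Qed.

(** Lebesgue's differentiation theorem for [G] extended by 0 outside [[a, b]]. As [x < b], both
    primitives agree near [x]. *)
Lemma ae_is_derive_Rintegral G a b :
  mu.-integrable `[a, b] (EFin \o G) ->
  {ae mu, forall x, a < x < b ->
    is_derive x (1 : R) (fun y => \int[mu]_(t in `[a, y]) G t)%R (G x)}.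
Proof.
move=> iG; pose G' := G \_ `[a, b].
have lG' : locally_integrable [set: R] G' by exact: integrable_locally.
have iG' : mu.-integrable [set: R] (EFin \o G').
  by move: iG; rewrite integrable_mkcond //= restrict_EFin.
have iGy y : mu.-integrable [set` Interval (BLeft a) (BRight y)] (EFin \o G').
  by apply: integrableS iG'.
have := @FTC1 R G' (BLeft a) iGy lG'.
apply: filterS; first exact: (ae_filter_ringOfSetsType mu).
move=> x /= Fx /andP[ax xb].
have [dF F'] := Fx ax.
have nearE : \forall y \near x, \int[mu]_(t in `[a, y]) G' t =
    \int[mu]_(t in `[a, y]) G t.
  near=> y; apply: eq_Rintegral => t /set_mem /=.
  rewrite in_itv /= => /andP[ta ty].
  rewrite /G' patchE mem_set //= in_itv /= ta /= (le_trans ty) // ltW //.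
  by near: y; exact: lt_nbhsl.
apply: DeriveDef; first exact: near_eq_derivable nearE dF.
rewrite -(near_eq_derive _ nearE) -derive1E F' /G' patchE mem_set //=.
by rewrite in_itv /= !ltW.
Unshelve. all: by end_near. Qed.

Lemma Rintegral_increment_le G (T L s t : R) :
  mu.-integrable `[0, T] (EFin \o G) ->
  {ae mu, forall x, 0 < x < T -> G x <= L} ->
  0 <= s -> s <= t -> t <= T ->
  (\int[mu]_(x in `[0, t]) G x)%R - (\int[mu]_(x in `[0, s]) G x)%R
    <= L * (t - s).
Proof.
move=> iG GL s0 st tT.
have sub (b0 b1 : bool) a b : 0 <= a -> b <= T ->
    [set` Interval (BSide b0 a) (BSide b1 b)] `<=` `[0, T].
  move=> a0 bT; apply: subset_itv; rewrite bnd_simp //.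
have iGt (b0 b1 : bool) :
    mu.-integrable [set` Interval (BSide b0 s) (BSide b1 t)] (EFin \o G).
  by apply: integrableS iG => //; exact: sub.
rewrite Rintegral_itvB ?bnd_simp //; last first.
  by apply: integrableS iG => //; exact: sub.
(* The bound on [G] is known on an open interval only, so the right endpoint is dropped. *)
rewrite -Rintegral_itv_bndo_bndc; last first.
  by have /integrableP[/measurable_EFinP] := iGt false true.
have icst : mu.-integrable `]s, t[ (EFin \o cst L).
  apply: measurable_bounded_integrable => //; first exact: lebesgue_itv_lty.
  exists `|L|; split; first exact: num_real.
  by move=> M LM x _ /=; rewrite ltW.
have -> : L * (t - s) = (\int[mu]_(x in `]s, t[) L)%R.
  rewrite Rintegral_cst // [X in fine X](lebesgue_measure_itv `]s, t[) /=.
  rewrite lte_fin.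
  by case: ltgtP st => // ->; rewrite subrr mulr0.
rewrite -subr_ge0 -RintegralB // /Rintegral /=.
have iLG : mu.-integrable `]s, t[ (fun x => (L - G x)%:E).
  by apply: (integrableB _ icst (iGt false true)).
(* [L - G] is nonnegative only almost everywhere; its absolute value has the same integral and is
   nonnegative everywhere. *)
have -> : (\int[mu]_(x in `]s, t[) (L - G x)%:E =
    \int[mu]_(x in `]s, t[) `|L - G x|%:E)%E.
  apply: ae_eq_integral => //.
  - by have /integrableP[] := iLG.
  - apply/measurable_EFinP/measurableT_comp => //.
    by have /integrableP[/measurable_EFinP] := iLG.
  move: GL; apply: filterS; first exact: (ae_filter_ringOfSetsType mu).
  move=> x GL; rewrite /= in_itv /= => /andP[sx xt].
  by rewrite ger0_norm // subr_ge0 GL // (le_lt_trans s0) //= (lt_le_trans xt).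
by apply: fine_ge0; apply: integral_ge0 => x _; rewrite lee_fin.
Qed.

End real_line.

(** * Lipschitz functions recovered from their difference quotients *)

Section difference_quotients.
Context (R : realType).
Notation mu := (@lebesgue_measure R).
Implicit Types (phi Phi : R -> R) (a t e L T x : R).

Lemma continuous_primitive phi a : continuous phi ->
  exists Phi, forall x, a < x -> is_derive x (1 : R) Phi (phi x).
Proof.
move=> cphi; exists (fun x => \int[mu]_(t in `[a, x]) phi t)%R => x ax.
have iphi : mu.-integrable `[a, x + 1] (EFin \o phi).
  apply: continuous_compact_integrable; first exact: segment_compact.
  exact: continuous_subspaceT.
have x1 : x < x + 1 by rewrite ltrDl.
have [dF F'] := continuous_FTC1_closed x1 iphi ax (cphi x).
by apply: DeriveDef; [exact: dF|rewrite -derive1E].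
Qed.

(** The step [e] may be negative, which gives backward quotients; [e = 0] gives the value 0. *)
Definition quotient phi e x : R := e^-1 * (phi (x + e) - phi x).

Lemma quotient_continuous phi e : continuous phi ->
  continuous (quotient phi e).
Proof.
move=> cphi x; apply: cvgM; first exact: cvg_cst.
apply: cvgB; last exact: cphi.
apply: (@cvg_comp _ _ _ (fun y => y + e) phi _ (nbhs (x + e))); last first.
  exact: cphi.
by apply: cvgD; [exact: cvg_id|exact: cvg_cst].
Qed.

Lemma is_derive_quotient phi Phi e x :
  is_derive x (1 : R) Phi (phi x) ->
  is_derive (x + e) (1 : R) Phi (phi (x + e)) ->
  is_derive x (1 : R) (quotient Phi e) (quotient phi e x).
Proof.
move=> dPhi dPhie.
have dshift : is_derive x (1 : R) (shift e) 1 by exact: is_derive_shift.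
have dcomp : is_derive x (1 : R) (Phi \o shift e) (phi (x + e)).
  by have := @is_derive1_comp _ Phi (shift e) x _ _ dPhie dshift; rewrite mulr1.
exact: is_deriveZ (is_deriveB dcomp dPhi).
Qed.

(** [quotient Phi e] is a primitive of [quotient phi e] on [[0, t]]. The bound [-2] leaves room for
    the shifted points [x + e], which are at least [-1]. *)
Lemma Rintegral_quotient phi Phi t e : continuous phi ->
  (forall x, - 2 < x -> is_derive x (1 : R) Phi (phi x)) ->
  0 < t -> `|e| <= 1 ->
  (\int[mu]_(x in `[0, t]) quotient phi e x)%R =
  quotient Phi e t - quotient Phi e 0.
Proof.
move=> cphi dPhi t0; rewrite ler_norml => /andP[e1 e2].
have dQ (x : R) : 0 <= x ->
    is_derive x (1 : R) (quotient Phi e) (quotient phi e x).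
  move=> x0; apply: is_derive_quotient; apply: dPhi; lra.
have cQ (x : R) : 0 <= x -> quotient Phi e y @[y --> x] --> quotient Phi e x.
  by move=> /dQ [+ _] => /derivable1_diffP/differentiable_continuous.
rewrite /Rintegral (@continuous_FTC2 _ _ (quotient Phi e)) //.
- by apply: continuous_subspaceT; exact: quotient_continuous.
- split.
  + by move=> x; rewrite in_itv /= => /andP[/ltW/dQ[]].
  + by apply: cvg_at_right_filter; exact: cQ.
  + by apply: cvg_at_left_filter; apply: cQ; exact: ltW.
- move=> x; rewrite in_itv /= => /andP[/ltW/dQ dx _].
  by rewrite derive1E; exact: derive_val.
Qed.

Lemma cvg_quotient_derive Phi t l (e_ : nat -> R) :
  is_derive t (1 : R) Phi l -> (forall n, e_ n != 0) ->
  e_ n @[n --> \oo] --> 0 ->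
  quotient Phi (e_ n) t @[n --> \oo] --> l.
Proof.
move=> [dPhi Phil] e0 ecv.
have : h^-1 *: ((Phi \o shift t) (h *: (1 : R)) - Phi t) @[h --> 0^'] --> l.
  by rewrite -Phil; exact: dPhi.
have ecv' : e_ n @[n --> \oo] --> 0^'.
  move=> A A0; have : \forall n \near \oo, e_ n != 0 -> A (e_ n) := ecv _ A0.
  by apply: filterS => n; apply.
move=> /(cvg_comp _ _ ecv'); apply: cvg_trans; apply: near_eq_cvg.
by apply: nearW => n; rewrite /= /quotient [_ *: (1 : R)]mulr1 (addrC t).
Qed.

(** For [t > 0] the integral is a difference of quotients of a primitive of [phi], taken at [t] and
    at 0; they tend to the values of [phi] there. *)
Lemma cvg_Rintegral_quotient phi (e_ : nat -> R) t :
  continuous phi -> (forall n, e_ n != 0) -> (forall n, `|e_ n| <= 1) ->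
  e_ n @[n --> \oo] --> 0 -> 0 <= t ->
  (\int[mu]_(x in `[0, t]) quotient phi (e_ n) x)%R @[n --> \oo]
    --> phi t - phi 0.
Proof.
move=> cphi e0 e1 ecv; rewrite le_eqVlt => /predU1P[<-|t0].
  rewrite subrr (_ : (fun _ => _) = fun=> 0); first exact: cvg_cst.
  by apply/funext => n; rewrite set_itv1 Rintegral_set1.
have [Phi dPhi] := continuous_primitive (- 2) cphi.
rewrite (_ : (fun _ => _) =
    fun n => quotient Phi (e_ n) t - quotient Phi (e_ n) 0); last first.
  by apply/funext => n; exact: Rintegral_quotient.
by apply: cvgB; apply: cvg_quotient_derive => //; apply: dPhi; lra.
Qed.

(* With [psi] the liminf of the forward difference quotients and [chi] that of
   the opposites of the backward ones, Fatou bounds their integrals by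
   [phi t - phi 0] and its opposite, and [psi + chi >= 0] almost everywhere. *)
Lemma lipschitz_subdifferentiable_integral phi L T :
  (forall x y, `|phi x - phi y| <= L * `|x - y|) ->
  {ae mu, forall x, 0 < x < T -> exists c, forall e, 0 < e ->
     \forall h \near 0, c * h - e * `|h| <= phi (x + h) - phi x} ->
  exists2 psi, mu.-integrable `[0, T] (EFin \o psi) &
    forall t, 0 <= t <= T ->
      phi t - phi 0 = (\int[mu]_(x in `[0, t]) psi x)%R.
Proof.
move=> phiL phic.
have L0 : 0 <= L.
  by have := phiL 1 0; rewrite subr0 normr1 mulr1; apply: le_trans.
have cphi : continuous phi.
  have L1 : 0 < L + 1 by rewrite ltr_wpDl.
  move=> x; apply/cvgrPdist_le => e e0; near=> y.
  have : `|x - y| <= e / (L + 1).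
    near: y; apply: cvgr_dist_le; first exact: cvg_id.
    exact: divr_gt0.
  rewrite ler_pdivlMr //; have := phiL x y; have := normr_ge0 (x - y); nra.
pose d n : R := n.+1%:R^-1.
have d0 n : 0 < d n by rewrite invr_gt0.
have dcv : d n @[n --> \oo] --> 0 by exact: cvg_harmonic.
have d1 n : `|d n| <= 1 by rewrite gtr0_norm // invf_le1 // ler1n.
have quotL e x : `|quotient phi e x| <= L.
  rewrite /quotient normrM; have [->|e0] := eqVneq e 0.
    by rewrite invr0 normr0 mul0r.
  rewrite normfV ler_pdivrMl ?normr_gt0 // mulrC.
  by have := phiL (x + e) x; rewrite addrAC subrr add0r.
pose u n x := quotient phi (d n) x.
pose v n x := - quotient phi (- d n) x.
have uL n x : `|u n x| <= L by exact: quotL.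
have vL n x : `|v n x| <= L by rewrite normrN quotL.
have mu_ n : measurable_fun setT (u n).
  by apply: continuous_measurable_fun; exact: quotient_continuous.
have mv_ n : measurable_fun setT (v n).
  apply: measurableT_comp => //.
  by apply: continuous_measurable_fun; exact: quotient_continuous.
pose psi x := fine (limn_einf (fun n => (u n x)%:E)).
pose chi x := fine (limn_einf (fun n => (v n x)%:E)).
have integr (g : R -> R) t : measurable_fun setT g -> (forall x, `|g x| <= L) ->
    mu.-integrable `[0, t] (EFin \o g).
  move=> mg gL; apply: measurable_bounded_integrable => //.
  - exact: lebesgue_itv_lty.
  - exact: measurable_funTS.
  exists L; split; first exact: num_real.
  by move=> M LM x _ /=; rewrite (le_trans (gL x)) // ltW.
have ipsi t : mu.-integrable `[0, t] (EFin \o psi).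
  by apply: integr; [exact: measurable_fine_limn_einf uL mu_|
    exact: normr_fine_limn_einf].
have ichi t : mu.-integrable `[0, t] (EFin \o chi).
  by apply: integr; [exact: measurable_fine_limn_einf vL mv_|
    exact: normr_fine_limn_einf].
exists psi => // t /andP[t0 tT].
have fI := lebesgue_itv_lty 0 t true false.
have psi_le : (\int[mu]_(x in `[0, t]) psi x)%R <= phi t - phi 0.
  apply: (@fatou_fine_limn_einf _ _ _ mu _ _ uL mu_) => //.
  by apply: cvg_Rintegral_quotient => // n; rewrite gt_eqF.
have chi_le : (\int[mu]_(x in `[0, t]) chi x)%R <= - (phi t - phi 0).
  apply: (@fatou_fine_limn_einf _ _ _ mu _ _ vL mv_) => //.
  rewrite (_ : (fun _ => _) = fun n =>
      - (\int[mu]_(x in `[0, t]) quotient phi (- d n) x)%R); last first.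
    apply/funext => n; rewrite -mulN1r -RintegralZl //.
      by apply: eq_Rintegral => x _; rewrite mulN1r.
    apply: integr => //; apply: continuous_measurable_fun.
    exact: quotient_continuous.
  apply: cvgN; apply: cvg_Rintegral_quotient => //.
  - by move=> n; rewrite oppr_eq0 gt_eqF.
  - by move=> n; rewrite normrN.
  - by rewrite -oppr0; exact: cvgN.
have psi_chi : {ae mu, forall x, 0 < x < T -> - (psi x + chi x) <= 0}.
  move: phic; apply: filterS; first exact: (ae_filter_ringOfSetsType mu).
  move=> x phix x0T; have [c {}phix] := phix x0T.
  (* The forward quotients are eventually at least [c - e / 2], the opposites of the backward ones
     at least [- c - e / 2]; [c] cancels in the sum. *)
  rewrite oppr_le0; apply/ler_addgt0Pl => e e0.
  have e20 : 0 < e / 2 by rewrite divr_gt0.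
  have uc : c - e / 2 <= psi x.
    apply: fine_limn_einf_ge uL _ _ _.
    have : \forall n \near \oo,
        c * d n - e / 2 * `|d n| <= phi (x + d n) - phi x := dcv _ (phix _ e20).
    apply: filterS => n /=.
    rewrite gtr0_norm // -mulrBl /u /quotient => h.
    by rewrite ler_pdivlMl // mulrC.
  have vc : - c - e / 2 <= chi x.
    apply: fine_limn_einf_ge vL _ _ _.
    have Ndcv : - d n @[n --> \oo] --> 0 by rewrite -oppr0; exact: cvgN.
    have : \forall n \near \oo,
        c * - d n - e / 2 * `|- d n| <= phi (x - d n) - phi x :=
      Ndcv _ (phix _ e20).
    apply: filterS => n /=.
    rewrite normrN gtr0_norm // mulrN -opprD -mulrDl /v /quotient => h.
    rewrite invrN mulNr opprK ler_pdivlMl //.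
    by rewrite mulrC -opprD mulNr.
  lra.
have isum : mu.-integrable `[0, T] (EFin \o (fun x => - (psi x + chi x))).
  have isum0 : mu.-integrable `[0, T] (fun x => (psi x + chi x)%:E).
    by apply: (integrableD _ (ipsi T) (ichi T)).
  exact: (integrableN isum0).
(* The integrals of [psi] and [chi] over [[0, t]] have a nonnegative sum, while [psi_le] and
   [chi_le] bound that sum by 0; so both are equalities. *)
have := Rintegral_increment_le isum psi_chi (lexx 0) t0 tT.
rewrite mul0r set_itv1 Rintegral_set1 subr0.
have -> : (\int[mu]_(x in `[0, t]) - (psi x + chi x))%R =
    - ((\int[mu]_(x in `[0, t]) psi x) + (\int[mu]_(x in `[0, t]) chi x))%R.
  rewrite -RintegralD // -mulN1r -RintegralZl //.
    by apply: eq_Rintegral => x _; rewrite mulN1r.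
  exact: (integrableD _ (ipsi t) (ichi t)).
move=> h; apply/eqP; rewrite eq_le psi_le andbT; lra.
Unshelve. all: by end_near. Qed.

End difference_quotients.

(** * Lipschitz continuity with an explicit constant *)

Section lipschitz_on_sets.
Context (R : realType) (V W : normedModType R).
Implicit Types (A : set V) (g : V -> W).

Lemma lipschitz_inP A g :
  [lipschitz g x | x in A] <->
  exists2 L : R, 0 <= L &
    forall x y, A x -> A y -> `|g x - g y| <= L * `|x - y|.
Proof.
split=> [[M [_ gM]]|[L L0 gL]].
  (* Only constants above [M] are known to work, and [M] may be negative; [|M| + 1] is above [M] and
     nonnegative. *)
  exists (`|M| + 1); first by rewrite addr_ge0.
  move=> x y Ax Ay; have MM : M < `|M| + 1.
    by rewrite (le_lt_trans (ler_norm _)) // ltrDl.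
  exact: (gM _ MM (x, y)).
exists L; split; first exact: num_real.
move=> M LM [x y] [/= Ax Ay].
by rewrite (le_trans (gL _ _ Ax Ay)) // ler_wpM2r // ltW.
Qed.

End lipschitz_on_sets.

(** * First-order expansions of real functions *)

Section frechet.
Context (R : realType).
Implicit Types (g phi : R -> R) (x c : R).

Lemma is_derive_near g x c : is_derive x (1 : R) g c ->
  forall e : R, 0 < e ->
    \forall h \near 0, `|g (x + h) - g x - c * h| <= e * `|h|.
Proof.
move=> [dg gc] e e0.
have : h^-1 *: ((g \o shift x) (h *: (1 : R)) - g x) @[h --> 0^'] --> c.
  by rewrite -gc; exact: dg.
move=> /cvgrPdist_le/(_ _ e0) gx.
have {gx} : \forall h \near (0 : R), h != 0 ->
    `|c - h^-1 *: ((g \o shift x) (h *: (1 : R)) - g x)| <= e := gx.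
apply: filterS => h; have [->|h0] := eqVneq h 0.
  by rewrite addr0 subrr mulr0 subrr normr0 mulr0.
move=> /(_ isT); rewrite /= [_ *: (1 : R)]mulr1 (addrC h) => ghx.
have -> : g (x + h) - g x - c * h = - (c - h^-1 *: (g (x + h) - g x)) * h.
  by rewrite opprB mulrBl [_ *: _]mulrC mulfVK.
by rewrite normrM normrN ler_wpM2r.
Qed.

(** Dividing by a negative increment reverses the lower bound, which is why [l] comes out below
    [c]. *)
Lemma subdifferential_ge_derive phi x c l :
  (forall e : R, 0 < e ->
     \forall h \near 0, c * h - e * `|h| <= phi (x + h) - phi x) ->
  is_derive x (1 : R) phi l -> l <= c.
Proof.
move=> phic /is_derive_near phil; apply/ler_addgt0Pl => e e0.
have e20 : 0 < e / 2 by rewrite divr_gt0.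
have [d /= d0 dP] := filterI (phic _ e20) (phil _ e20).
have d2 : 0 < d / 2 by rewrite divr_gt0.
have /dP[] : ball_ Num.norm 0 d (- (d / 2)).
  by rewrite /= sub0r opprK gtr0_norm // ltr_pdivrMr // ltr_pMr // ltr1n.
rewrite normrN gtr0_norm // ler_norml => h1 /andP[_ h2].
have : l * (d / 2) <= (e + c) * (d / 2) by lra.
by rewrite ler_pM2r.
Qed.

End frechet.

(** * Absolutely continuous curves tested against vectors *)

Section scalar_components.
Context (R : realType) (H : normedModType R) (dot : {dot H for idfun}).
Hypothesis dot_norm : forall x : H, dot x x = `|x| ^+ 2.
Notation mu := (@lebesgue_measure R).
Implicit Types (u : R -> H) (w : H) (T L s t : R).

Lemma is_derive_dot u w t : derivable u t 1 ->
  is_derive t (1 : R) (fun s => dot (u s) w) (dot (derive1 u t) w).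
Proof.
move=> du.
have cv : h^-1 *: (((fun s => dot (u s) w) \o shift t) (h *: (1 : R))
    - dot (u t) w) @[h --> 0^'] --> dot (derive1 u t) w.
  have -> : (fun h : R => h^-1 *: (((fun s => dot (u s) w) \o shift t)
      (h *: (1 : R)) - dot (u t) w)) =
      fun h : R => dot (h^-1 *: ((u \o shift t) (h *: (1 : R)) - u t)) w.
    by apply/funext => h; rewrite dotZl dotBl.
  have cvu : h^-1 *: ((u \o shift t) (h *: (1 : R)) - u t) @[h --> 0^']
      --> derive1 u t by rewrite derive1E; exact: du.
  exact: (@continuous_cvg _ _ _ _ _ _ (dot ^~ w) _
    (@dot_continuous _ _ _ dot_norm w _) cvu).
by apply: DeriveDef; [apply/cvg_ex; eexists; exact: cv|apply/cvg_lim].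
Qed.

(** The Bochner integrals over [[0, t]] and [[0, T]] yield two real densities, both equal to
    [dot (g x) w] almost everywhere on [[0, t]]; so the one on [[0, T]] serves every [t]. *)
Lemma abs_continuous_scalar T u : abs_continuous T u ->
  exists C : R, forall w, `|w| <= 1 -> exists G : R -> R,
  [/\ mu.-integrable `[0, T] (EFin \o G),
      forall t, 0 <= t <= T ->
        (\int[mu]_(x in `[0, t]) G x)%R = dot (u t - u 0) w &
      (\int[mu]_(x in `[0, T]) `|G x| <= C)%R].
Proof.
move=> [g [I gI] gu].
have kle w : `|w| <= 1 -> forall x, `|applyr dot w x| <= `|x|.
  move=> w1 x; rewrite applyrE (le_trans (normr_dot_le dot_norm _ _)) //.
  by rewrite ler_piMr.
have mI (s : R) : measurable (`[0, s]%classic : set (measurableTypeR R)) by [].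
have [C CP] := is_bochner_integral_scalar (mI T)
  (lebesgue_itv_lty 0 T true false) gI.
exists C => w w1.
have [G [iG Gg _ GC]] := CP (applyr dot w) (kle w w1).
exists G; split => // t /andP[t0 tT].
have [|C' /(_ (applyr dot w) (kle w w1))] :=
    is_bochner_integral_scalar (mI t)
      (lebesgue_itv_lty 0 t true false) (gu t _).
  by rewrite in_itv /= t0.
move=> [G' [iG' G'g G'u _]]; rewrite -applyrE -G'u /Rintegral; congr fine.
have sub : `[0, t] `<=` `[0, T] by apply: subset_itvl; rewrite bnd_simp.
apply: ae_eq_integral => //.
- by have /integrableP[] := integrableS (mI T) (mI t) sub iG.
- by have /integrableP[] := iG'.
move: Gg G'g; apply: filterS2 => x Gx G'x /= xt.
by rewrite Gx ?G'x //; exact: sub.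
Qed.

Lemma abs_continuous_bounded T u : abs_continuous T u ->
  exists M : R, forall t, 0 <= t <= T -> `|u t| <= M.
Proof.
move=> /abs_continuous_scalar[C CP].
have C0 : 0 <= C.
  have [|G [_ _]] := CP 0; first by rewrite normr0.
  by apply: le_trans; apply: Rintegral_ge0.
exists (`|u 0| + C) => t t0T; have /andP[t0 tT] := t0T.
rewrite -{1}(subrKC (u 0) (u t)) (le_trans (ler_normD _ _)) // lerD2l.
apply: (le_norm_dot dot_norm) => // w w1.
have [G [iG Gu GC]] := CP w w1.
have sub : `[0, t] `<=` `[0, T] by apply: subset_itvl; rewrite bnd_simp.
have iGt : mu.-integrable `[0, t] (EFin \o G) by apply: integrableS iG.
rewrite -Gu // (le_trans (ler_norm _)) //.
rewrite (le_trans (le_normr_Rintegral _ iGt)) // (le_trans _ GC) //.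
rewrite -lee_fin !EFin_Rintegral_normr //.
apply: ge0_subset_integral => //.
have /integrableP[/measurable_EFinP mG _] := iG.
exact/measurable_EFinP/measurableT_comp.
Qed.

(** For each [w], the density of [dot (u t) w] is almost everywhere [dot (derive1 u t) w], at most
    [L]. The exceptional set depends on [w], harmlessly: the increment is bounded for each [w]
    before passing to the norm. *)
Lemma abs_continuous_lipschitz T u L : 0 <= L -> abs_continuous T u ->
  {ae mu, forall t, 0 < t < T -> derivable u t 1 /\ `|derive1 u t| <= L} ->
  forall s t, 0 <= s -> s <= t -> t <= T -> `|u t - u s| <= L * (t - s).
Proof.
move=> L0 /abs_continuous_scalar[C CP] uL s t s0 st tT.
apply: (le_norm_dot dot_norm); first by rewrite mulr_ge0 // subr_ge0.
move=> w w1; have [G [iG Gu _]] := CP w w1.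
have -> : dot (u t - u s) w =
    (\int[mu]_(x in `[0, t]) G x)%R - (\int[mu]_(x in `[0, s]) G x)%R.
  rewrite !Gu ?s0 ?(le_trans s0 st) ?(le_trans st) // -dotBl.
  by rewrite opprB addrA subrK.
apply: (Rintegral_increment_le iG) => //.
have := ae_is_derive_Rintegral iG; move: uL.
apply: filterS2; first exact: (ae_filter_ringOfSetsType mu).
move=> x ux Gx x0T.
have [dux uxL] := ux x0T.
have dG := Gx x0T.
have du := is_derive_dot w dux.
have dB : is_derive x (1 : R) (fun y => dot (u y) w - dot (u 0) w)
  (dot (derive1 u x) w - 0) := is_deriveB du (is_derive_cst _ _ _).
have E : \forall y \near x, (\int[mu]_(x in `[0, y]) G x)%R =
    dot (u y) w - dot (u 0) w.
  have /andP[x0 xT] := x0T.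
  near=> y; rewrite Gu ?dotBl //; apply/andP; split; apply: ltW.
    by near: y; exact: lt_nbhsr.
  by near: y; exact: lt_nbhsl.
have -> : G x = dot (derive1 u x) w.
  rewrite -(@derive_val _ _ _ _ _ _ _ dG) (near_eq_derive _ E).
  by rewrite (@derive_val _ _ _ _ _ _ _ dB) subr0.
rewrite (le_trans (dot_le_norm dot_norm _ _)) // -(mulr1 L).
by rewrite ler_pM.
Unshelve. all: by end_near. Qed.

End scalar_components.

(** * Speed and descent along solutions of (MOG) *)

Section mog.
Context (R : realType) (H : normedModType R) (dot : {dot H for idfun}).
Hypothesis dot_norm : forall x : H, dot x x = `|x| ^+ 2.
Notation mu := (@lebesgue_measure R).
Variables (K : set H) (q : nat) (f : 'I_q -> H -> R) (u : R -> H).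
Hypothesis u_sol : strong_global_solution dot K f u.

Lemma mog_subgradient : {ae mu, forall t : R, 0 < t ->
  derivable u t 1 /\ forall i, exists2 p, subdifferential dot (f i) (u t) p &
    dot (derive1 u t) p <= - `|derive1 u t| ^+ 2}.
Proof.
have [eta [v [theta [_ _ _ _]]]] := sgs_equation u_sol.
apply: filterS; first exact: (ae_filter_ringOfSetsType mu).
move=> t ut t0; have [_ vf du _ zmin] := ut t0.
split=> // i; exists (v i t) => //.
have := least_norm_subdifferential dot_norm zmin (vf i).
by rewrite normrN dotNl lerNr.
Qed.

(** [|u'|^2 <= - <u', p> <= |u'| |p|] and [|p| <= L]: a single objective already bounds the
    speed. *)
Lemma mog_speed_le (i : 'I_q) (M L : R) : 0 <= L ->
  (forall y z, `|y| <= M + 1 -> `|z| <= M + 1 ->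
     `|f i y - f i z| <= L * `|y - z|) ->
  {ae mu, forall t : R, 0 < t -> `|u t| <= M ->
    derivable u t 1 /\ `|derive1 u t| <= L}.
Proof.
move=> L0 fL; have := mog_subgradient.
apply: filterS; first exact: (ae_filter_ringOfSetsType mu).
move=> t ut t0 utM; have [du /(_ i)[p fp up]] := ut t0.
split=> //; have pL := norm_subdifferential_le dot_norm L0 fL utM fp.
have [->|] := eqVneq (derive1 u t) 0; first by rewrite normr0.
rewrite -normr_gt0 => u0; rewrite -(ler_pM2l u0).
apply: (@le_trans _ _ (`|derive1 u t| * `|p|)); last first.
  by rewrite ler_wpM2l // ltW.
rewrite -(normrN (derive1 u t)) (le_trans _ (dot_le_norm dot_norm _ _)) //.
by rewrite dotNl lerNr normrN -expr2.
Qed.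

(** [T] does not enter the constant [L], so a trajectory confined to one ball has the same constant
    on every interval. *)
Lemma mog_lipschitz (i : 'I_q) (M L T : R) : 0 <= L -> 0 < T ->
  (forall y z, `|y| <= M + 1 -> `|z| <= M + 1 ->
     `|f i y - f i z| <= L * `|y - z|) ->
  (forall t, 0 <= t <= T -> `|u t| <= M) ->
  forall s t, 0 <= s <= T -> 0 <= t <= T -> `|u s - u t| <= L * `|s - t|.
Proof.
move=> L0 T0 fL uM.
have lip s t : 0 <= s -> s <= t -> t <= T -> `|u t - u s| <= L * (t - s).
  apply: (abs_continuous_lipschitz dot_norm L0).
    exact: sgs_abs_continuous u_sol _ T0.
  have := mog_speed_le L0 fL.
  apply: filterS; first exact: (ae_filter_ringOfSetsType mu).
  move=> x ux /andP[x0 xT].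
  by apply: ux => //; apply: uM; rewrite !ltW.
move=> s t /andP[s0 sT] /andP[t0 tT]; have [st|/ltW ts] := leP s t.
  by rewrite distrC (distrC s) (ger0_norm (x := t - s)) ?subr_ge0 // lip.
by rewrite (ger0_norm (x := s - t)) ?subr_ge0 // lip.
Qed.

Lemma mog_descent (i : 'I_q) (L1 L2 T : R) : 0 <= L1 -> 0 <= L2 -> 0 < T ->
  (forall s t, 0 <= s <= T -> 0 <= t <= T -> `|u s - u t| <= L1 * `|s - t|) ->
  (forall s t, 0 <= s <= T -> 0 <= t <= T ->
     `|f i (u s) - f i (u t)| <= L2 * `|u s - u t|) ->
  exists psi : R -> R,
  [/\ mu.-integrable `[0, T] (EFin \o psi),
      forall t, 0 <= t <= T ->
        f i (u t) - f i (u 0) = (\int[mu]_(x in `[0, t]) psi x)%R &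
      {ae mu, forall t : R, 0 < t < T ->
        is_derive t (1 : R) (fun s => f i (u s)) (psi t) /\
        psi t <= - `|derive1 u t| ^+ 2}].
Proof.
move=> L10 L20 T0 uL fuL.
(* Freezing time outside [[0, T]] makes [phi] Lipschitz on the whole line, as
   [lipschitz_subdifferentiable_integral] requires. *)
pose clamp (x : R) := Num.max 0 (Num.min x T).
have clampT x : 0 <= clamp x <= T.
  by rewrite le_max lexx /= ge_max (ltW T0) ge_min lexx orbT.
have clampE x : 0 <= x <= T -> clamp x = x.
  by move=> /andP[x0 xT]; rewrite /clamp (min_idPl xT) (max_idPr x0).
have clampL x y : `|clamp x - clamp y| <= `|x - y|.
  rewrite ler_norml; have := ler_norm (x - y); have := ler_norm (y - x).
  rewrite (distrC y) /clamp => h1 h2.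
  by case: (leP x T) => ?; case: (leP y T) => ?; case: (leP 0 T) => ?;
    case: (leP 0 x) => ?; case: (leP 0 y) => ?; lra.
pose phi x := f i (u (clamp x)).
have phiL x y : `|phi x - phi y| <= (L2 * L1) * `|x - y|.
  rewrite (le_trans (fuL _ _ _ _)) // -mulrA ler_wpM2l //.
  by rewrite (le_trans (uL _ _ _ _)) // ler_wpM2l.
have inT (t : R) : 0 < t < T -> \forall y \near t, 0 <= y <= T.
  move=> /andP[t0 tT]; near=> y; apply/andP; split; apply: ltW.
    by near: y; exact: lt_nbhsr.
  by near: y; exact: lt_nbhsl.
(* The subgradient inequality at [u (t + h)], combined with the first-order expansion of
   [dot (u s) p] at [s = t]. *)
have sub t p : 0 < t < T -> derivable u t 1 ->
    subdifferential dot (f i) (u t) p ->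
    forall e : R, 0 < e -> \forall h \near 0,
      dot (derive1 u t) p * h - e * `|h| <= phi (t + h) - phi t.
  move=> t0T du fp e e0.
  have nearT : \forall h \near (0 : R), 0 <= t + h <= T.
    by have := inT _ t0T; rewrite -{1}(addr0 t) => /nbhsDr.
  have := is_derive_near (is_derive_dot dot_norm p du) e0.
  apply: filterS2 nearT => h h0T; rewrite ler_norml => /andP[+ _].
  have /andP[t0 tT] := t0T.
  rewrite /phi !clampE ?(ltW t0) ?(ltW tT) //.
  have := fp (u (t + h)); rewrite dotBr !(dotC dot p); lra.
have := mog_subgradient => subg.
have [|psi ipsi phi_psi] :=
    @lipschitz_subdifferentiable_integral _ phi (L2 * L1) T phiL.
  move: subg; apply: filterS; first exact: (ae_filter_ringOfSetsType mu).
  move=> t ut t0T.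
  have /andP[t0 _] := t0T; have [du /(_ i)[p fp _]] := ut t0.
  by exists (dot (derive1 u t) p) => e; exact: sub.
exists psi; split => //.
  move=> t t0T; rewrite -phi_psi // /phi !clampE //.
  by rewrite lexx ltW.
(* Almost everywhere [psi] is the derivative of its primitive, hence of [f i] along [u]. *)
move: subg (ae_is_derive_Rintegral ipsi).
apply: filterS2; first exact: (ae_filter_ringOfSetsType mu).
move=> t ut dpsi t0T.
have /andP[t0 tT] := t0T; have [du /(_ i)[p fp pu]] := ut t0.
have dphi : is_derive t (1 : R) (fun s => f i (u s)) (psi t).
  have := is_deriveD (is_derive_cst (phi 0) t 1) (dpsi t0T).
  rewrite add0r => -[d1 d2].
  have E : \forall y \near t,
      (cst (phi 0) + (fun y => \int[mu]_(x in `[0, y]) psi x)%R) y = f i (u y).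
    have := inT _ t0T; apply: filterS => y y0T.
    by rewrite fctE /= -phi_psi // subrKC /phi clampE.
  apply: DeriveDef; first exact: near_eq_derivable E d1.
  by rewrite -(near_eq_derive _ E).
(* It remains to bound the derivative [psi t] by the slope [dot (derive1 u t) p] of the lower
   expansion. *)
split=> //; rewrite (le_trans _ pu) //.
apply: subdifferential_ge_derive dphi => e e0.
have := sub _ _ t0T du fp e e0.
have nearT : \forall h \near (0 : R), 0 <= t + h <= T.
  by have := inT _ t0T; rewrite -{1}(addr0 t) => /nbhsDr.
by apply: filterS2 nearT => h h0T; rewrite /phi !clampE ?(ltW t0) ?(ltW tT).
Unshelve. all: by end_near. Qed.

End mog.

Theorem proposition1p15 (R : realType) (H : completeNormedModType R)
    (dot : {dot H for idfun}) (dot_norm : forall x : H, dot x x = `|x| ^+ 2)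
    (K : set H) (K_neq0 : K !=set0) (K_closed : closed K)
    (K_convex : convex_set K)
    (q : nat) (q_gt0 : (0 < q)%N) (f : 'I_q -> H -> R)
    (f_convex : forall i, convex_function [set: H] (f i))
    (f_continuous : forall i, continuous (f i))
    (f_lipschitz : forall i (B : set H), bounded_set B ->
      [lipschitz (f i) x | x in B])
    (u : R -> H) (u_sol : strong_global_solution dot K f u) :
  (forall i,
    [/\ {in `[0, +oo[ &, nonincreasing_fun (fun t => f i (u t))},
        forall T : R, 0 < T -> abs_continuous T (fun t => f i (u t) : R) &
        {ae (@lebesgue_measure R), forall t : R, 0 < t ->
          derivable (fun s => f i (u s)) t 1 /\
          derive1 (fun s => f i (u s)) t <= - `|derive1 u t| ^+ 2}]) /\
  (forall T : R, 0 < T -> [lipschitz (u t) | t in `[0, T]]) /\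
  ([bounded (u t) | t in `[0, +oo[] -> [lipschitz (u t) | t in `[0, +oo[]).
Proof.
have f_lip i (M : R) : exists2 L : R, 0 <= L &
    forall y z, `|y| <= M -> `|z| <= M -> `|f i y - f i z| <= L * `|y - z|.
  have bM : bounded_set [set y : H | `|y| <= M].
    exists M; split; first exact: num_real.
    by move=> N MN y /= /le_trans; apply; exact: ltW.
  have /lipschitz_inP[L L0 fL] := f_lipschitz i _ bM.
  by exists L => // y z yM zM; exact: fL.
(* Any one objective serves to bound the speed; [q_gt0] provides it. *)
pose i0 := Ordinal q_gt0.
have u_lip T : 0 < T -> exists2 L : R, 0 <= L &
    forall s t, 0 <= s <= T -> 0 <= t <= T -> `|u s - u t| <= L * `|s - t|.
  move=> T0; have [M uM] := abs_continuous_bounded dot_norm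
    (sgs_abs_continuous u_sol T0).
  have [L L0 fL] := f_lip i0 (M + 1).
  by exists L => //; exact: (mog_lipschitz dot_norm u_sol L0 T0 fL uM).
have descent i (T : R) (T0 : 0 < T) : exists psi : R -> R,
  [/\ (@lebesgue_measure R).-integrable `[0, T] (EFin \o psi),
      forall t, 0 <= t <= T -> f i (u t) - f i (u 0) =
        (\int[@lebesgue_measure R]_(x in `[0, t]) psi x)%R &
      {ae (@lebesgue_measure R), forall t : R, 0 < t < T ->
        is_derive t (1 : R) (fun s => f i (u s)) (psi t) /\
        psi t <= - `|derive1 u t| ^+ 2}].
  have [M uM] := abs_continuous_bounded dot_norm
    (sgs_abs_continuous u_sol T0).
  have [L1 L10 uL] := u_lip T T0.
  have [L2 L20 fL] := f_lip i M.
  apply: (mog_descent dot_norm u_sol L10 L20 T0 uL) => s t sT tT.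
  by apply: fL; exact: uM.
split; last split.
- move=> i; split.
  + move=> t s; rewrite !in_itv /= !andbT => t0 s0 ts.
    (* The horizon [s + 1] is positive even when [s = 0]. *)
    have T0 : 0 < s + 1 by rewrite ltr_wpDl.
    have [psi [ipsi psiE ae_psi]] := descent i _ T0.
    have ss : s <= s + 1 by rewrite lerDl.
    rewrite -subr_le0.
    have -> : f i (u s) - f i (u t) =
        (\int[@lebesgue_measure R]_(x in `[0, s]) psi x)%R -
        (\int[@lebesgue_measure R]_(x in `[0, t]) psi x)%R.
      rewrite -!psiE ?s0 ?t0 ?(le_trans ts) //.
      by rewrite opprB addrA subrK.
    suff psi_le0 : {ae (@lebesgue_measure R), forall x : R,
        0 < x < s + 1 -> psi x <= 0}.
      by have := Rintegral_increment_le ipsi psi_le0 t0 ts ss; rewrite mul0r.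
    move: ae_psi; apply: filterS.
      exact: (ae_filter_ringOfSetsType (@lebesgue_measure R)).
    move=> x px x0T.
    by have [_ /le_trans] := px x0T; apply; rewrite oppr_le0 sqr_ge0.
  + move=> T T0; have [psi [ipsi psiE _]] := descent i T T0.
    have mI (s : R) :
      measurable (`[0, s]%classic : set (measurableTypeR R)) by [].
    exists psi.
      exists (\int[@lebesgue_measure R]_(x in `[0, T]) psi x)%R.
      exact: (integrable_is_bochner_integral (mI T)
        (lebesgue_itv_lty 0 T true false) ipsi).
    move=> t; rewrite in_itv /= => /andP[t0 tT].
    rewrite psiE ?t0 //.
    apply: (integrable_is_bochner_integral (mI t)
      (lebesgue_itv_lty 0 t true false)).
    by apply: integrableS ipsi => //; apply: subset_itvl; rewrite bnd_simp.
  (* The half-line is the union of the intervals []0, n + 1[], so countably many null sets are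
     gathered into one. *)
  + have : {ae (@lebesgue_measure R), forall t : R, forall n : nat,
        0 < t < n.+1%:R -> derivable (fun s => f i (u s)) t 1 /\
        derive1 (fun s => f i (u s)) t <= - `|derive1 u t| ^+ 2}.
      apply/ae_foralln => n.
      have [psi [_ _]] := descent i n.+1%:R (ltr0Sn _ _).
      apply: filterS.
        exact: (ae_filter_ringOfSetsType (@lebesgue_measure R)).
      move=> t pt t0n; have [dpsi psi_le] := pt t0n.
      split; first exact: ex_derive.
      by rewrite derive1E (@derive_val _ _ _ _ _ _ _ dpsi).
    apply: filterS.
      exact: (ae_filter_ringOfSetsType (@lebesgue_measure R)).
    move=> t ut t0; apply: (ut (Num.trunc t)).
    by rewrite t0 /=; exact: truncnS_gt.
- move=> T T0; have [L L0 uL] := u_lip T T0.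
  apply/lipschitz_inP; exists L => // s t; rewrite /= !in_itv /=; exact: uL.
move=> [M0 [_ uM0]]; pose M := `|M0| + 1.
have uM t : 0 <= t -> `|u t| <= M.
  move=> t0; apply: uM0; last by rewrite /= in_itv /= t0.
  by rewrite (le_lt_trans (ler_norm _)) // ltrDl.
(* The constant is fixed by the bound [M] on the whole trajectory, before [s] and [t]; the horizon
   [s + t + 1] then covers both times. *)
have [L L0 fL] := f_lip i0 (M + 1).
apply/lipschitz_inP; exists L => // s t; rewrite /= !in_itv /= !andbT => s0 t0.
have T0 : 0 < s + t + 1 by rewrite ltr_wpDl // addr_ge0.
apply: (mog_lipschitz dot_norm u_sol L0 T0 fL).
- by move=> x /andP[x0 _]; exact: uM.
- by rewrite s0 /=; lra.
- by rewrite t0 /=; lra.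
Qed.
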